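(* Let $M$ be a log-convex weight sequence. Then the following are equivalent: (i) $H^{\infty}_{\underline{\mathcal M}_{\mathfrak c}}$ is closed under point-wise multiplication and the multiplication operator $\mathfrak m:(f,g)\mapsto f\cdot g$ acts continuously on this space (i.e. $\mathfrak m:H^{\infty}_{\underline{\mathcal M}_{\mathfrak c}}\times H^{\infty}_{\underline{\mathcal M}_{\mathfrak c}}\to H^{\infty}_{\underline{\mathcal M}_{\mathfrak c}}$ is continuous); (ii) $H^{\infty}_{\overline{\mathcal M}_{\mathfrak c}}$ is closed under point-wise multiplication and $\mathfrak m$ acts continuously on this space; (iii) there exists $C\ge1$ such that $M_{j+k}\le C^{j+k}M_jM_k$ for all $j,k\in\mathbb{N}$.
   Context: $\mathbb{N}=\{0,1,2,\dots\}$, $\mathbb{N}_{>0}=\{1,2,\dots\}$. For a positive function $v$ on $[0,+\infty)$, $H^{\infty}_v:=\{f\in H(\mathbb{C}):\|f\|_v:=\sup_{z\in\mathbb{C}}|f(z)|v(|z|)<+\infty\}$, where $H(\mathbb{C})$ is the space of entire functions; for the weights below this is a Banach space with norm $\|\cdot\|_v$. A weight sequence is $M=(M_j)_{j\in\mathbb{N}}$ with $M_j>0$, $M_0=1$ and $\lim_{j\to+\infty}(M_j)^{1/j}=+\infty$; it is log-convex if $M_j^2\le M_{j-1}M_{j+1}$ for all $j\ge1$. Put $\omega_M(t):=\sup_{j\in\mathbb{N}}\log(t^j/M_j)$ for $t>0$, $\omega_M(0):=0$, and for $c>0$ let $v_{M,c}(t):=\exp(-\omega_M(ct))$. Put $\underline{\mathcal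 M}_{\mathfrak c}:=(v_{M,c})_{c\in\mathbb{N}_{>0}}$ and $\overline{\mathcal M}_{\mathfrak c}:=(v_{M,1/c})_{c\in\mathbb{N}_{>0}}$. $H^{\infty}_{\underline{\mathcal M}_{\mathfrak c}}:=\varinjlim_{c\to\infty}H^{\infty}_{v_{M,c}}$ is the locally convex inductive limit (an (LB)-space; as a set the union), and $H^{\infty}_{\overline{\mathcal M}_{\mathfrak c}}:=\varprojlim_{c\to\infty}H^{\infty}_{v_{M,1/c}}$ is the projective limit (a Fréchet space; as a set the intersection). *)

(* Defs.v *)
From HB Require Import structures.
From mathcomp Require Import all_boot all_order all_algebra.
From mathcomp Require Import all_classical all_reals all_analysis.
From mathcomp Require Import complex.

Set Implicit Arguments.
Unset Strict Implicit.
Unset Printing Implicit Defensive.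

Import Order.TTheory GRing.Theory Num.Theory.
Import numFieldNormedType.Exports.
Import ComplexField.Normc.

Local Open Scope classical_set_scope.
Local Open Scope ring_scope.
Local Open Scope complex_scope.

(** The real-valued modulus is [normc : R[i] -> R].  Complex functions are typed
    [R[i]^o -> R[i]^o] because the canonical normed module over the field [R[i]]
    is [R[i]^o]; thus [derivable f z 1] is complex differentiability at [z]. *)
Definition entire (R : realType) (f : R[i]^o -> R[i]^o) : Prop :=
  forall z : R[i]^o, derivable f z 1.

Record weight (R : realType) := Weight {
  wfun :> R -> R;
  wfun_gt0 : forall t, 0 <= t -> 0 < wfun t }.

Definition wnorm (R : realType) (v : R -> R) (f : R[i]^o -> R[i]^o) : \bar R :=
  ereal_sup [set (normc (f z) * v (normc z))%:E | z in [set: R[i]^o]].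

Definition Hv_pred (R : realType) (v : R -> R) (f : R[i]^o -> R[i]^o) : Prop :=
  entire f /\ (wnorm v f < +oo)%E.

Section entire_lmodule.
Variable R : realType.
Implicit Types (f g : R[i]^o -> R[i]^o) (v : weight R).

Lemma normc_ge0 (z : R[i]) : 0 <= normc z.
Proof. by case: z => a b /=; exact: sqrtr_ge0. Qed.

Lemma normcCE (z : R[i]) : `|z| = (normc z)%:C.
Proof. by []. Qed.

Lemma entire0 : entire (0 : R[i]^o -> R[i]^o).
Proof. by move=> z; exact: derivable_cst. Qed.

Lemma entireD f g : entire f -> entire g -> entire (f + g).
Proof. by move=> ef eg z; exact: derivableD. Qed.

Lemma entireZ (a : R[i]) f : entire f -> entire (a *: f).
Proof. by move=> ef z; exact: derivableZ. Qed.

Lemma wnorm_ub (v : R -> R) f z : ((normc (f z) * v (normc z))%:E <= wnorm v f)%E.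
Proof. by apply: ereal_sup_ubound; exists z. Qed.

Lemma wnorm_ge0 v f : (0 <= wnorm v f)%E.
Proof.
apply: le_trans (wnorm_ub _ _ 0); rewrite lee_fin mulr_ge0 ?normc_ge0//.
exact/ltW/wfun_gt0/normc_ge0.
Qed.

Lemma wnorm_fin v f : (wnorm v f < +oo)%E -> wnorm v f = (fine (wnorm v f))%:E.
Proof. by move=> h; rewrite fineK// ge0_fin_numE// wnorm_ge0. Qed.

Lemma wnorm_le (v : R -> R) f (c : R) :
  (forall z, normc (f z) * v (normc z) <= c) -> (wnorm v f <= c%:E)%E.
Proof. by move=> h; apply: ge_ereal_sup => _ [z _ <-]; rewrite lee_fin. Qed.

Lemma wnormD v f g : (wnorm v (f + g)%R <= wnorm v f + wnorm v g)%E.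
Proof.
apply: ge_ereal_sup => _ [z _ <-]; have vz := wfun_gt0 v (normc_ge0 z).
apply: (@le_trans _ _ ((normc (f z) * v (normc z))%:E
                       + (normc (g z) * v (normc z))%:E)%E).
  by rewrite -EFinD lee_fin -mulrDl ler_pM2r// le_normcD.
by apply: leeD; exact: wnorm_ub.
Qed.

Lemma wnormZ v (a : R[i]) f : (wnorm v f < +oo)%E ->
  wnorm v (a *: f) = ((normc a)%:E * wnorm v f)%E.
Proof.
move=> h; have pt z b g : normc ((b *: g : R[i]^o -> R[i]^o) z) * v (normc z)
    = normc b * (normc (g z) * v (normc z)).
  by rewrite [(b *: g) z]/(b * g z) normcM mulrA.
have le1 b g : (wnorm v g < +oo)%E ->
    (wnorm v (b *: g) <= (normc b)%:E * wnorm v g)%E.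
  move=> hg; rewrite (wnorm_fin hg) -EFinM; apply: wnorm_le => z.
  rewrite pt ler_wpM2l ?normc_ge0// -lee_fin -(wnorm_fin hg).
  exact: wnorm_ub.
apply/eqP; rewrite eq_le le1//=.
have [->|a0] := eqVneq a 0; first by rewrite normc0 mul0e wnorm_ge0.
have na0 : 0 < normc a.
  by rewrite lt_neqAle normc_ge0 andbT eq_sym; apply: contra a0 => /eqP/eq0_normc->.
have haf : (wnorm v (a *: f) < +oo)%E.
  by apply: le_lt_trans (le1 _ _ h) _; rewrite (wnorm_fin h) -EFinM ltry.
have /= := le1 a^-1 _ haf.
rewrite scalerA mulVf// scale1r normcV.
by rewrite (wnorm_fin h) (wnorm_fin haf) -!EFinM !lee_fin ler_pdivlMl.
Qed.

Lemma Hv_pred0 v : Hv_pred v 0.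
Proof.
split; first exact: entire0.
apply: (@le_lt_trans _ _ 0%:E); last exact: ltry.
by apply: wnorm_le => z; rewrite normc0 mul0r.
Qed.

Lemma Hv_predD v f g : Hv_pred v f -> Hv_pred v g -> Hv_pred v (f + g).
Proof.
move=> [ef hf] [eg hg]; split; first exact: entireD.
by apply: le_lt_trans (wnormD _ _ _) _; apply: lte_add_pinfty.
Qed.

Lemma Hv_predZ v (a : R[i]) f : Hv_pred v f -> Hv_pred v (a *: f).
Proof.
move=> [ef hf]; split; first exact: entireZ.
by rewrite wnormZ// (wnorm_fin hf) -EFinM ltry.
Qed.

End entire_lmodule.

Definition Hv_mem (R : realType) (v : weight R) : {pred (R[i]^o -> R[i]^o)} :=
  fun f => `[< Hv_pred v f >].

Lemma Hv_submod (R : realType) (v : weight R) : submod_closed (Hv_mem v).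
Proof.
split; first exact/asboolP/Hv_pred0.
by move=> a f g /asboolP hf /asboolP hg; apply/asboolP/Hv_predD => //; exact: Hv_predZ.
Qed.

HB.instance Definition _ (R : realType) (v : weight R) :=
  GRing.isSubmodClosed.Build R[i] (R[i]^o -> R[i]^o)%type (Hv_mem v) (Hv_submod v).

Record Hv (R : realType) (v : weight R) :=
  MkHv { Hv_fun :> R[i]^o -> R[i]^o; Hv_funP : Hv_mem v Hv_fun }.

HB.instance Definition _ (R : realType) (v : weight R) := [isSub for @Hv_fun R v].
HB.instance Definition _ (R : realType) (v : weight R) := [Choice of Hv v by <:].
HB.instance Definition _ (R : realType) (v : weight R) :=
  [SubChoice_isSubLmodule of Hv v by <:].

Section Hv_norm.
Variables (R : realType) (v : weight R).
Implicit Types f g : Hv v.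

(** In MathComp the norm of a normed module over [R[i]] takes values in [R[i]]. *)
Definition Hv_norm f : R[i] := (fine (wnorm v f))%:C.

Lemma Hv_funPP f : Hv_pred v f.
Proof. exact/asboolP/Hv_funP. Qed.

Lemma Hv_fin f : wnorm v f = (fine (wnorm v f))%:E.
Proof. by apply: wnorm_fin; case: (Hv_funPP f). Qed.

Lemma Hv_ler_normD f g : Hv_norm (f + g) <= Hv_norm f + Hv_norm g.
Proof.
rewrite /Hv_norm -rmorphD lecR -lee_fin EFinD -!Hv_fin; exact: wnormD.
Qed.

Lemma Hv_normrZ (a : R[i]) f : Hv_norm (a *: f) = `|a| * Hv_norm f.
Proof.
rewrite /Hv_norm normcCE -rmorphM; congr (_%:C).
apply: EFin_inj; rewrite EFinM -!Hv_fin; apply: wnormZ.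
by case: (Hv_funPP f).
Qed.

Lemma Hv_normr0_eq0 f : Hv_norm f = 0 -> f = 0.
Proof.
move=> [f0]; apply/val_inj/funext => z /=; apply: eq0_normc.
have := wnorm_ub v f z; rewrite Hv_fin f0 lee_fin pmulr_lle0; last first.
  exact/wfun_gt0/normc_ge0.
by move=> h; apply/eqP; rewrite eq_le h normc_ge0.
Qed.

End Hv_norm.

HB.instance Definition _ (R : realType) (v : weight R) :=
  Lmodule_isNormed.Build R[i] (Hv v)
    (@Hv_ler_normD R v) (@Hv_normrZ R v) (@Hv_normr0_eq0 R v).

(** [E] is the union of the images of the linear maps [u n : F n -> E].  A set is
   a neighbourhood of [x] iff it contains [x + V] with [V] absolutely convex and
   every preimage of [V] under [u n] a neighbourhood of [0].  This makes [E] a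
   locally convex space ([tvsType]); by [indlim_univ] its topology is the finest
   locally convex one for which all the [u n] are continuous. *)

Definition absolutely_convex (K : numFieldType) (E : lmodType K) (V : set E) :=
  forall (x y : E) (a b : K), V x -> V y -> `|a| + `|b| <= 1 ->
    V (a *: x + b *: y).

Definition indlim (K : numFieldType) (E : lmodType K)
  (F : nat -> normedModType K) (u : forall n, {linear F n -> E})
  (cover : forall x : E, exists n, exists y : F n, u n y = x) : Type := E.

Section indlim.
Variables (K : numFieldType) (E : lmodType K) (F : nat -> normedModType K).
Variables (u : forall n, {linear F n -> E}).
Variable cover : forall x : E, exists n, exists y : F n, u n y = x.
Local Notation L := (indlim cover).

HB.instance Definition _ := GRing.Lmodule.on L.

Let nbhs_preimage (S T : topologicalType) (f : S -> T) x A :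
  {for x, continuous f} -> nbhs (f x) A -> nbhs x (f @^-1` A).
Proof. by move=> cf nA; exact: cf. Qed.

Definition indlim_nbhd0 (V : set L) : Prop :=
  absolutely_convex V /\ forall n, nbhs (0 : F n) (u n @^-1` V).

Definition indlim_nbhs (x : L) : set_system L :=
  [set U | exists2 V, indlim_nbhd0 V & forall y, V y -> U (x + y)].

HB.instance Definition _ := hasNbhs.Build L indlim_nbhs.

Lemma indlim_nbhd00 V : indlim_nbhd0 V -> V 0.
Proof. by move=> [_ /(_ 0%N)/nbhs_singleton] /=; rewrite linear0. Qed.

Lemma indlim_nbhd0Z V (c : K) : indlim_nbhd0 V ->
  indlim_nbhd0 [set x | V (c *: x)].
Proof.
move=> [aV nV]; split => [x y a b Vx Vy ab|n] /=.
  by rewrite scalerDr !scalerA ![c * _]mulrC -!scalerA; exact: aV.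
have nc : nbhs (c *: (0 : F n)) (u n @^-1` V) by rewrite scaler0; exact: nV.
apply: filterS (nbhs_preimage (@scaler_continuous K (F n) c 0) nc) => y /=.
by rewrite linearZ.
Qed.

Lemma indlim_nbhd0I V W : indlim_nbhd0 V -> indlim_nbhd0 W ->
  indlim_nbhd0 (V `&` W).
Proof.
move=> [aV nV] [aW nW]; split => [x y a b [Vx Wx] [Vy Wy] ab|n].
  by split; [exact: aV|exact: aW].
exact: filterI.
Qed.

Lemma indlim_nbhd0B V (x : L) (c : K) :
  indlim_nbhd0 V -> V x -> `|c| <= 1 -> V (c *: x).
Proof.
move=> nV Vx c1; have := nV.1 x 0 c 0 Vx (indlim_nbhd00 nV).
by rewrite normr0 addr0 scaler0 addr0; apply.
Qed.

Lemma half_norm : `|2^-1 : K| + `|2^-1 : K| = 1.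
Proof. by rewrite ger0_norm ?invr_ge0// -mulr2n -[LHS]mulr_natl mulfV ?pnatr_eq0. Qed.

Lemma indlim_nbhd0D V (x y : L) :
  indlim_nbhd0 V -> V (2 *: x) -> V (2 *: y) -> V (x + y).
Proof.
move=> [aV _] Vx Vy; have := aV _ _ 2^-1 2^-1 Vx Vy.
by rewrite !scalerA mulVf// !scale1r half_norm lexx; apply.
Qed.

Lemma indlim_filter (x : L) : ProperFilter (nbhs x).
Proof.
split.
  by move=> [V nV h]; apply: (h 0); exact: indlim_nbhd00.
split.
- exists setT => //; split=> // n; exact: filterT.
- move=> A B [V nV hA] [W nW hB]; exists (V `&` W); first exact: indlim_nbhd0I.
  by move=> y [Vy Wy]; split; [exact: hA|exact: hB].
- by move=> A B AB [V nV hA]; exists V => // y Vy; apply/AB/hA.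
Qed.

Lemma indlim_nbhs_singleton (x : L) A : nbhs x A -> A x.
Proof.
by move=> [V nV h]; rewrite -[x]addr0; apply: h; exact: indlim_nbhd00.
Qed.

Lemma indlim_nbhs_nbhs (x : L) A : nbhs x A -> nbhs x (nbhs^~ A).
Proof.
move=> [V nV h]; exists [set y | V (2 *: y)]; first exact: indlim_nbhd0Z.
move=> y Vy; exists [set y | V (2 *: y)]; first exact: indlim_nbhd0Z.
by move=> z Vz; rewrite -addrA; apply: h; exact: indlim_nbhd0D.
Qed.

HB.instance Definition _ := Nbhs_isNbhsTopological.Build L
  indlim_filter indlim_nbhs_singleton indlim_nbhs_nbhs.

Lemma indlim_nbhd0_nbhs (V : set L) (x : L) : indlim_nbhd0 V ->
  nbhs x [set y | V (y - x)].
Proof. by move=> nV; exists V => // y Vy /=; rewrite addrAC subrr add0r. Qed.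

Lemma indlim_add_continuous : continuous (fun x : L * L => x.1 + x.2).
Proof.
move=> [x y] A [V nV h].
have n2 := indlim_nbhd0Z 2 nV.
exists ([set z | V (2 *: (z - x))], [set z | V (2 *: (z - y))]).
  by split; exact: (indlim_nbhd0_nbhs _ n2).
move=> [a b] [/= Va Vb]; rewrite (_ : a + b = x + y + ((a - x) + (b - y))).
  by apply: h; exact: indlim_nbhd0D.
by rewrite addrACA ![_ + (_ - _)]addrC !subrK.
Qed.

Lemma indlim_scale_continuous : continuous (fun z : K^o * L => z.1 *: z.2).
Proof.
move=> [k x] A [V nV h] /=.
have [n [y yx]] := cover x.
have n1 : nbhs k [set l : K^o | V (2 *: ((l - k) *: x)) ].
  have nc : nbhs (2 *: ((k - k) *: y)) (u n @^-1` V).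
    by rewrite subrr scale0r scaler0; exact: nV.2.
  have c : {for k, continuous (fun l : K^o => 2 *: ((l - k) *: y))}.
    apply: (@continuous_comp K^o (F n) (F n) (fun l => (l - k) *: y)
      (fun z => 2 *: z)); last exact: scaler_continuous.
    apply: (@continuous_comp K^o K^o (F n) (fun l => l - k)
      (fun l => l *: y)); last exact: scalel_continuous.
    apply: (@continuousB K K^o K^o idfun (fun=> k)).
      by move=> ?.
    exact: cst_continuous.
  apply: filterS (nbhs_preimage c nc) => l /=.
  by rewrite linearZ/= [u n _]linearZ/= yx.
have n2 : nbhs k [set l : K^o | `|l| <= `|k| + 1].
  exists 1 => //= l kl /=; rewrite -lerBlDl; apply: le_trans (lerB_dist _ _) _.
  by rewrite -[X in `|X|]opprB normrN ltW.
have M0 : 0 < `|k| + 1 by rewrite ltr_wpDl.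
exists ([set l | V (2 *: ((l - k) *: x)) /\ `|l| <= `|k| + 1],
        [set z | V ((2 * (`|k| + 1)) *: (z - x))]).
  split; first exact: filterI.
  exact: (indlim_nbhd0_nbhs _ (indlim_nbhd0Z _ nV)).
move=> [l z] [/= [Vl lM] Vz].
rewrite (_ : l *: z = k *: x + (l *: (z - x) + (l - k) *: x)); last first.
  by rewrite scalerBl scalerBr subrKA addrC subrK.
apply: h; apply: indlim_nbhd0D => //.
have -> : 2 *: (l *: (z - x)) =
    (l / (`|k| + 1)) *: ((2 * (`|k| + 1)) *: (z - x)).
  by rewrite !scalerA mulrCA divfK ?gt_eqF// mulrC.
apply: indlim_nbhd0B => //.
by rewrite normrM normfV (gtr0_norm M0) ler_pdivrMr// mul1r.
Qed.

Lemma indlim_locally_convex :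
  exists2 B : set_system L, (forall b, b \in B -> convex_set b) & basis B.
Proof.
exists [set b | open b /\ convex_set b]; first by move=> b; rewrite inE => -[].
split; first by move=> b [].
move=> x U [V nV h]; exists (interior [set y | V (y - x)]).
  split; last by apply: (indlim_nbhd0_nbhs _ nV).
  split; first exact: open_interior.
  move=> a b t; rewrite !inE => -[V1 nV1 h1] [V2 nV2 h2].
  exists (V1 `&` V2); first exact: indlim_nbhd0I.
  move=> y [V1y V2y] /=.
  have t0 : 0 <= t%:num by [].
  have t1 : 0 <= 1 - t%:num by rewrite subr_ge0 le1.
  have := nV.1 _ _ t%:num (1 - t%:num) (h1 _ V1y) (h2 _ V2y).
  rewrite !ger0_norm// addrC subrK lexx => /(_ isT); congr V.
  rewrite -!(addrA _ y); move: (y - x) => w.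
  by rewrite !scalerDr addrACA -scalerDl [t%:num + _]addrC subrK scale1r.
move=> y /nbhs_singleton /= Vy.
by have := h _ Vy; rewrite addrC subrK.
Qed.

(* [PreTopologicalLmod_isTvs] only builds the uniform structure. *)
HB.instance Definition _ := PreTopologicalLmod_isTvs.Build K L
  indlim_add_continuous indlim_scale_continuous indlim_locally_convex.
HB.instance Definition _ := PreTopologicalNmodule_isTopologicalNmodule.Build L
  indlim_add_continuous.
HB.instance Definition _ := TopologicalNmodule_isTopologicalLmodule.Build K L
  indlim_scale_continuous.
HB.instance Definition _ := Uniform_isTvs.Build K L indlim_locally_convex.

Lemma indlim_incl_continuous n : continuous (u n : F n -> L).
Proof.
move=> x A [V nV h].
have := nV.2 n; rewrite -(subrr x) => nb.
have c : {for x, continuous (fun y : F n => y - x)}.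
  by apply: continuousB; [exact: cvg_id|exact: cvg_cst].
apply: filterS (nbhs_preimage c nb) => y /=; rewrite linearB/= => /h.
by rewrite addrC subrK.
Qed.

Lemma indlim_univ (G : tvsType K) (g : {linear L -> G}) :
  (forall n, continuous (g \o u n : F n -> G)) -> continuous g.
Proof.
move=> gu x U nU.
have nU0 : nbhs (0 : G) [set y | U (g x + y)].
  have c : {for 0, continuous (fun y : G => g x + y)}.
    apply: (@continuous_comp G (G * G)%type G (fun y => (g x, y))
      (fun z => z.1 + z.2)); last exact: add_continuous.
    by apply: cvg_pair; [exact: cvg_cst|exact: cvg_id].
  by apply: (nbhs_preimage c); rewrite addr0.
have [B Bconv [Bo /(_ 0 _ nU0) [W [BW W0] WU]]] := @locally_convex K G.
have cW := Bconv _ (mem_set BW).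
pose A := [set y : G | forall c : K, `|c| <= 1 -> W (c *: y)].
have nW : nbhs (0 : G) W by apply: open_nbhs_nbhs; split => //; exact: Bo.
have nA : nbhs (0 : G) A.
  have /= := @scale_continuous K G (0, 0) W.
  rewrite scaler0 => /(_ nW) [[P Q] [/= [e e0 eP] nQ] PQ].
  have e2 : e / 2 != 0 by rewrite gt_eqF// divr_gt0.
  apply: filterS (nbhs0Z e2 nQ) => _ [y Qy <-] c c1.
  rewrite scalerA; apply: (PQ (c * (e / 2), y)); split=> //=; apply: eP => /=.
  rewrite sub0r normrN normrM (gtr0_norm (divr_gt0 e0 _))//.
  apply: (@le_lt_trans _ _ (e / 2)); last by rewrite ltr_pdivrMr// ltr_pMr// ltr1n.
  by rewrite ler_piMl// ltW// divr_gt0.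
have aA : absolutely_convex A.
  move=> y z a b Ay Az ab c c1.
  have cW01 (w1 w2 : G) (t : K) : W w1 -> W w2 -> 0 <= t -> t <= 1 ->
      W (t *: w1 + (1 - t) *: w2).
    move=> Ww1 Ww2 t0 t1.
    by have /set_mem := cW w1 w2 (Itv01 t0 t1) (mem_set Ww1) (mem_set Ww2).
  have phase (d : K) (w : G) : A w -> exists2 w', W w' & (c * d) *: w = `|d| *: w'.
    move=> Aw; have [->|d0] := eqVneq d 0.
      by exists 0 => //; rewrite mulr0 normr0 !scale0r.
    exists ((c * (d / `|d|)) *: w).
      apply: Aw; rewrite normrM normf_div normr_id divff ?mulr1//.
      by rewrite normr_eq0.
    by rewrite scalerA mulrCA [`|d| * _]mulrC divfK// normr_eq0.
  have [w1 Ww1 e1] := phase a y Ay; have [w2 Ww2 e2] := phase b z Az.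
  rewrite scalerDr !scalerA e1 e2.
  pose s := `|a| + `|b|.
  have [s0|s0] := eqVneq s 0.
    move/eqP: s0; rewrite paddr_eq0// => /andP[/eqP -> /eqP ->].
    by rewrite !scale0r addr0.
  have sp : 0 < s by rewrite lt_neqAle eq_sym s0 addr_ge0.
  have -> : `|a| *: w1 + `|b| *: w2 =
      s *: ((`|a| / s) *: w1 + (1 - `|a| / s) *: w2) + (1 - s) *: 0.
    rewrite scaler0 addr0 scalerDr !scalerA mulrBr mulr1 ![s * _]mulrC divfK//.
    by rewrite /s addrAC subrr add0r.
  apply: (cW01 _ _ _) => //; last exact: ltW.
  apply: cW01 => //; first by rewrite divr_ge0// ltW.
  by rewrite ler_pdivrMr// mul1r lerDl.
exists (g @^-1` A).
  split => [y z a b Ay Az ab|n] /=; first by rewrite linearD !linearZ; exact: aA.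
  by apply: (nbhs_preimage (@gu n 0)); rewrite /= !linear0.
move=> y Ay; rewrite /= linearD; apply: WU.
by have := Ay 1; rewrite normr1 lexx scale1r; apply.
Qed.

End indlim.

Record dec_weights (R : realType) := DecWeights {
  dwfun :> nat -> weight R;
  dwfun_dec : forall n m t, (n <= m)%N -> 0 <= t -> dwfun m t <= dwfun n t }.

Definition Hind_mem (R : realType) (V : dec_weights R) :
    {pred (R[i]^o -> R[i]^o)} :=
  fun f => `[< exists n, Hv_pred (V n) f >].

Lemma Hv_pred_le (R : realType) (v w : weight R) f :
  (forall t, 0 <= t -> w t <= v t) -> Hv_pred v f -> Hv_pred w f.
Proof.
move=> wv [ef fv]; split => //; apply: le_lt_trans fv.
apply: ge_ereal_sup => _ [z _ <-]; apply: le_trans (wnorm_ub v f z).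
by rewrite lee_fin ler_wpM2l ?normc_ge0// wv// normc_ge0.
Qed.

Lemma Hind_submod (R : realType) (V : dec_weights R) : submod_closed (Hind_mem V).
Proof.
split; first by apply/asboolP; exists 0%N; exact: Hv_pred0.
move=> a f g /asboolP[n hf] /asboolP[m hg]; apply/asboolP; exists (maxn n m).
apply: Hv_predD; first apply: Hv_predZ.
  by apply: Hv_pred_le hf => t t0; apply: dwfun_dec => //; exact: leq_maxl.
by apply: Hv_pred_le hg => t t0; apply: dwfun_dec => //; exact: leq_maxr.
Qed.

HB.instance Definition _ (R : realType) (V : dec_weights R) :=
  GRing.isSubmodClosed.Build R[i] (R[i]^o -> R[i]^o)%type (Hind_mem V)
    (Hind_submod V).

Record Hind (R : realType) (V : dec_weights R) :=
  MkHind { Hind_fun :> R[i]^o -> R[i]^o; Hind_funP : Hind_mem V Hind_fun }.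

HB.instance Definition _ (R : realType) (V : dec_weights R) :=
  [isSub for @Hind_fun R V].
HB.instance Definition _ (R : realType) (V : dec_weights R) :=
  [Choice of Hind V by <:].
HB.instance Definition _ (R : realType) (V : dec_weights R) :=
  [SubChoice_isSubLmodule of Hind V by <:].

Section Hind_topology.
Variables (R : realType) (V : dec_weights R).

Lemma Hind_inclP n (f : Hv (V n)) : Hind_mem V f.
Proof. by apply/asboolP; exists n; exact: Hv_funPP. Qed.

Definition Hind_incl n (f : Hv (V n)) : Hind V := MkHind (Hind_inclP f).

Lemma Hind_incl_linear n : linear (@Hind_incl n).
Proof. by move=> a f g; exact/val_inj. Qed.

HB.instance Definition _ n :=
  GRing.isLinear.Build R[i] (Hv (V n)) (Hind V) *:%R (@Hind_incl n)
    (@Hind_incl_linear n).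

Lemma Hind_cover (f : Hind V) : exists n, exists g : Hv (V n), Hind_incl g = f.
Proof.
have /asboolP[n /asboolP fn] := Hind_funP f.
by exists n, (MkHv fn); exact/val_inj.
Qed.

Definition Hind_indlim : tvsType R[i] :=
  @indlim R[i] (Hind V) (fun n => Hv (V n)) (fun n => @Hind_incl n) Hind_cover.

HB.instance Definition _ := Tvs.copy (Hind V) Hind_indlim.

End Hind_topology.

Definition Hproj_mem (R : realType) (V : nat -> weight R) :
    {pred (R[i]^o -> R[i]^o)} :=
  fun f => `[< forall n, Hv_pred (V n) f >].

Record Hproj (R : realType) (V : nat -> weight R) :=
  MkHproj { Hproj_fun :> R[i]^o -> R[i]^o; Hproj_funP : Hproj_mem V Hproj_fun }.

HB.instance Definition _ (R : realType) (V : nat -> weight R) :=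
  [isSub for @Hproj_fun R V].
HB.instance Definition _ (R : realType) (V : nat -> weight R) :=
  [Choice of Hproj V by <:].

Section Hproj_topology.
Variables (R : realType) (V : nat -> weight R).

Lemma Hproj_inclP n (f : Hproj V) : Hv_mem (V n) f.
Proof. by have /asboolP/(_ n)/asboolP := Hproj_funP f. Qed.

Definition Hproj_incl n (f : Hproj V) : Hv (V n) := MkHv (Hproj_inclP n f).

(** The projective topology: the coarsest one making every inclusion
    [Hproj_incl n] continuous. *)
Definition Hproj_projlim : Type :=
  sup_topology (fun n => Topological.class (initial_topology (@Hproj_incl n))).

HB.instance Definition _ := Topological.copy (Hproj V) Hproj_projlim.

End Hproj_topology.

Record weight_seq (R : realType) := WeightSeq {
  mseq :> nat -> R;
  mseq_gt0 : forall j, 0 < mseq j;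
  mseq0 : mseq 0 = 1;
  mseq_cvgy : mseq j `^ (j%:R^-1) @[j --> \oo] --> +oo }.

Definition log_convex (R : realType) (M : nat -> R) : Prop :=
  forall j, (0 < j)%N -> M j ^+ 2 <= M j.-1 * M j.+1.

(** The supremum is that of a bounded set when [M] is a weight sequence, see
    [omega_has_sup]. *)
Definition omega (R : realType) (M : nat -> R) (t : R) : R :=
  if 0 < t then sup [set ln (t ^+ j / M j) | j in [set: nat]] else 0.

Section omega_theory.
Variables (R : realType) (M : weight_seq R).

Lemma omega_has_sup (t : R) : 0 < t ->
  has_sup [set ln (t ^+ j / M j) | j in [set: nat]].
Proof.
move=> t0; split; first by exists (ln (t ^+ 0 / M 0)), 0%N.
have /cvgryPge/(_ t) [N _ hN] := mseq_cvgy M.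
exists (\sum_(i < N.+1) `|ln (t ^+ i / M i)|) => _ [j _ <-].
have [jN|Nj] := ltnP j N.+1.
  rewrite (bigD1 (Ordinal jN))//=; apply: (le_trans (ler_norm _)).
  by rewrite lerDl sumr_ge0.
apply: (@le_trans _ _ 0); last by rewrite sumr_ge0.
apply: ln_le0; rewrite ler_pdivrMr ?mseq_gt0// mul1r.
have tj : t <= M j `^ (j%:R^-1) by apply: hN; exact: ltnW.
have j0 : j%:R != 0 :> R by rewrite pnatr_eq0 -lt0n (leq_trans _ Nj).
have -> : M j = (M j `^ (j%:R^-1)) ^+ j.
  by rewrite -powR_mulrn ?powR_ge0// -powRrM mulVf// powRr1// ltW// mseq_gt0.
by rewrite lerXn2r// ?nnegrE ?powR_ge0// ltW.
Qed.

Lemma omega_ge0 (t : R) : 0 <= omega M t.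
Proof.
rewrite /omega; case: ifPn => // t0; apply: sup_upper_bound.
  exact: omega_has_sup.
by exists 0%N => //; rewrite expr0 mseq0 divr1 ln1.
Qed.

Lemma omega_le (s t : R) : s <= t -> omega M s <= omega M t.
Proof.
move=> st; rewrite {1}/omega; case: ifPn => s0; last exact: omega_ge0.
have t0 := lt_le_trans s0 st.
apply: ge_sup; first by have [] := omega_has_sup s0.
move=> _ [j _ <-]; rewrite /omega t0.
apply: (@le_trans _ _ (ln (t ^+ j / M j))).
  rewrite ler_ln ?posrE ?divr_gt0 ?exprn_gt0 ?mseq_gt0//.
  by rewrite ler_pM2r ?invr_gt0 ?mseq_gt0// lerXn2r// nnegrE ltW.
by apply: sup_upper_bound; [exact: omega_has_sup|exists j].
Qed.

Lemma vM_gt0 (c t : R) : 0 <= t -> 0 < expR (- omega M (c * t)).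
Proof. by rewrite expR_gt0. Qed.

Definition vM (c : R) : weight R := Weight (vM_gt0 c).

Lemma vM_dec n m t : (n <= m)%N -> 0 <= t -> vM m.+1%:R t <= vM n.+1%:R t.
Proof.
by move=> nm t0; rewrite ler_expR lerN2 omega_le// ler_wpM2r// ler_nat ltnS.
Qed.

(** The index [c] in {1, 2, ...} of the sequences is [n.+1] with [n : nat]. *)
Definition Munder : dec_weights R := DecWeights vM_dec.

Definition Mover (n : nat) : weight R := vM n.+1%:R^-1.

End omega_theory.

(** [m] takes values in [E], so its existence expresses that [E] is closed under
    point-wise multiplication; it is unique when [fn] is injective. *)
Definition mul_acts_continuously (R : realType) (E : topologicalType)
    (fn : E -> R[i]^o -> R[i]^o) : Prop :=
  exists2 m : E * E -> E,
    (forall f g : E, fn (m (f, g)) = (fun z => fn f z * fn g z)) &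
    continuous m.

(* Main.v *)
Require Import Defs.
From mathcomp Require Import all_boot all_order all_algebra.
From mathcomp Require Import all_classical all_reals all_analysis.
From mathcomp Require Import complex ring.

(** The growth condition [moderate_growth], M_(j+k) <= C^(j+k) M_j M_k, is linked
    to each of the two algebras separately.

    From the condition to the algebras.  Multiplying two terms of the suprema
    that define [omega M] turns the condition into 2 omega(t) <= omega(C t)
    ([expR_omega_sqr]), that is, v_(C c) <= (v_c)^2.  Hence a product of elements
    of the step spaces of v_c lies in the step space of v_(C c), with norm at most
    the product of the norms.  For the projective limit this is already
    continuity ([Hproj_mul_continuous]).  For the inductive limit one must find,
    for a given disk U, one disk W with W W in U; since there are only countably
    many steps, it is enough to shrink the ball of step n according to the ball
    that U contains in the step receiving the products ([Hind_mul_nbhd0_nbhd0]).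

    From the algebras to the condition.  Only monomials are needed.  In the step
    space of v_c the function e c^j/M_j z^j has norm at most e, by definition of
    omega.  When M is log-convex, omega attains its value at the term of index p
    as soon as t = M_(p+1)/M_p ([expR_omega_peak]), so evaluating at a single
    point the product of the monomials of degrees j and k, with p = j + k,
    compares M_(j+k) with M_j M_k ([smonomial_test]).  For the projective limit,
    continuity at 0 bounds products of monomials that are small for one v_c
    by the unit ball of v_1, and the test is the condition.  For the inductive
    limit, suppose that the condition fails for C = (n+1)^2 at degrees (j_n, k_n),
    for every n.  Let r_n be the point such that (n+1) r_n is the peak of
    index j_n + k_n, and let U be the set of f with
    |f(r_n)| <= exp(omega((n+1) r_n)) for all n.  In each step all but
    finitely many of these constraints hold on the unit ball, and the others on
    a smaller ball, so U is a neighbourhood of 0.  Continuity at (0,0) puts products of small multiples of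
    monomials in U, which the test refutes for large n ([Hind_moderate_growth]).
    No Taylor coefficient of a general entire function is involved: point
    evaluations replace the Cauchy estimates. *)

Set Implicit Arguments.
Unset Strict Implicit.
Unset Printing Implicit Defensive.

Import Order.TTheory GRing.Theory Num.Theory.
Import numFieldNormedType.Exports.
Import ComplexField.Normc.

Local Open Scope ring_scope.

(** * The weight function of a log-convex sequence *)

Section omega.
Variables (R : realType) (M : weight_seq R).

Lemma expR_omega_ub (t : R) j : 0 <= t -> t ^+ j / M j <= expR (omega M t).
Proof.
rewrite le_eqVlt => /predU1P[<-|t0].
  rewrite /omega ltxx expR0; case: j => [|j]; first by rewrite mseq0 divr1.
  by rewrite expr0n mul0r.
have p0 : 0 < t ^+ j / M j by rewrite divr_gt0 ?exprn_gt0 ?mseq_gt0.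
rewrite -[leLHS]lnK ?posrE// ler_expR /omega t0.
by apply: sup_upper_bound; [exact: omega_has_sup|exists j].
Qed.

Lemma expR_omega_le (t b : R) : 0 <= t -> 1 <= b ->
  (forall j, t ^+ j / M j <= b) -> expR (omega M t) <= b.
Proof.
move=> t0 b1 tb; have b0 : 0 < b by apply: lt_le_trans b1.
rewrite /omega; case: ifPn => [{}t0|_]; last by rewrite expR0.
rewrite -[leRHS]lnK ?posrE// ler_expR; apply: ge_sup.
  by have [] := omega_has_sup M t0.
move=> _ [j _ <-].
by rewrite ler_ln ?posrE ?divr_gt0 ?exprn_gt0 ?mseq_gt0.
Qed.

Lemma vME (c t : R) : vM M c t = (expR (omega M (c * t)))^-1.
Proof. by rewrite -expRN. Qed.

(** Log-convexity says that the quotients M_(i+1)/M_i increase, so at t = M_(p+1)/M_p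
    the sequence t^j/M_j increases up to j = p and decreases afterwards. *)
Lemma expR_omega_peak p : log_convex M ->
  expR (omega M (M p.+1 / M p)) = (M p.+1 / M p) ^+ p / M p.
Proof.
move=> lc; set r := M p.+1 / M p.
have M0 := mseq_gt0 M.
have r0 : 0 < r by rewrite divr_gt0.
have ratio i k : (i <= k)%N -> M i.+1 / M i <= M k.+1 / M k.
  move=> /subnK <-; elim: (k - i)%N => // n IH.
  apply: (le_trans IH); rewrite addSn; move: (n + i)%N => q.
  rewrite ler_pdivrMr// mulrAC ler_pdivlMr// -expr2 mulrC.
  exact: (lc q.+1).
apply/eqP; rewrite eq_le expR_omega_ub ?(ltW r0)// andbT.
have key j : r ^+ j / M j <= r ^+ p / M p.
  have step q : r ^+ q.+1 / M q.+1 = r ^+ q / M q * (r / (M q.+1 / M q)).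
    by rewrite exprSr; field; rewrite !gt_eqF.
  have a0 q : 0 <= r ^+ q / M q by rewrite divr_ge0 ?exprn_ge0 ?ltW.
  have [jp|pj] := leqP j p.
    rewrite -(subnK jp); have : (p - j + j <= p)%N by rewrite subnK.
    elim: (p - j)%N => // n IH np; apply: (le_trans (IH (ltnW np))).
    rewrite addSn step ler_peMr// ler_pdivlMr ?divr_gt0// mul1r.
    by apply: ratio; exact: ltnW.
  rewrite -(subnK (ltnW pj)); elim: (j - p)%N => // n IH.
  apply: le_trans IH.
  rewrite addSn step ler_piMr// ler_pdivrMr ?divr_gt0// mul1r.
  by apply: ratio; exact: leq_addl.
apply: expR_omega_le => //; first exact: ltW.
by have := key 0%N; rewrite expr0 mseq0 divr1.
Qed.

(** Each product of a term at j and a term at k is at most C^(j+k) t^(j+k)/M_(j+k),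
    a term of the supremum at C t. *)
Lemma expR_omega_sqr (C t : R) : 0 <= C -> 0 <= t ->
  (forall j k : nat, M (j + k)%N <= C ^+ (j + k) * M j * M k) ->
  expR (omega M t) ^+ 2 <= expR (omega M (C * t)).
Proof.
move=> C0 t0 MC; have M0 := mseq_gt0 M.
set w := expR (omega M (C * t)).
have key j k : (t ^+ j / M j) * (t ^+ k / M k) <= w.
  apply: le_trans (expR_omega_ub (j + k) (mulr_ge0 C0 t0)).
  rewrite ler_pdivlMr// exprMn.
  apply: le_trans (_ : (t ^+ j / M j) * (t ^+ k / M k) *
     (C ^+ (j + k) * M j * M k) <= _).
    by rewrite ler_wpM2l// !mulr_ge0 ?invr_ge0 ?exprn_ge0// ltW.
  by rewrite !exprD le_eqVlt; apply/orP; left; apply/eqP; field; rewrite !gt_eqF.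
have e0 s : 0 < expR (omega M s) by rewrite expR_gt0.
have [t_eq0|tn0] := eqVneq t 0.
  by rewrite /w t_eq0 mulr0 /omega ltxx expR0 expr1n.
have a0 k : 0 < t ^+ k / M k by rewrite divr_gt0// exprn_gt0// lt0r tn0.
have a0E : t ^+ 0 / M 0 = 1 by rewrite expr0 mseq0 divr1.
(* the suprema of the two factors are taken one after the other *)
have h k : expR (omega M t) * (t ^+ k / M k) <= w.
  rewrite -ler_pdivlMr//; apply: expR_omega_le => // [|j].
    by rewrite ler_pdivlMr// -a0E.
  by rewrite ler_pdivlMr.
rewrite expr2 -ler_pdivlMr//; apply: expR_omega_le => // [|k].
  by rewrite ler_pdivlMr// mul1r -[leLHS]mulr1 -a0E.
by rewrite ler_pdivlMr// mulrC.
Qed.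
End omega.

(** * Weighted sup-norm bounds *)

Section bounds.
Local Open Scope classical_set_scope.
Local Open Scope complex_scope.
Variable R : realType.
Implicit Types (f g : R[i]^o -> R[i]^o) (v w q : weight R).

(** The closed balls of all the spaces at hand, as predicates on plain functions:
    the same function can then be measured in different steps without casts. *)
Definition vbound (v : R -> R) (e : R) f :=
  forall z, normc (f z) * v (normc z) <= e.

Lemma vbound_ge0 v e f : vbound v e f -> 0 <= e.
Proof.
move=> /(_ 0); apply: le_trans; rewrite mulr_ge0 ?normc_ge0//.
exact/ltW/wfun_gt0/normc_ge0.
Qed.

Lemma vbound_le v w a b f : (forall t, 0 <= t -> w t <= v t) -> a <= b ->
  vbound v a f -> vbound w b f.
Proof.
move=> wv ab fa z; apply: le_trans (le_trans (fa z) ab).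
by rewrite ler_wpM2l ?normc_ge0// wv// normc_ge0.
Qed.

Lemma vboundM v w q a b f g : (forall t, 0 <= t -> q t <= v t * w t) ->
  vbound v a f -> vbound w b g -> vbound q (a * b) (f \* g).
Proof.
move=> qvw fa gb z; rewrite [(f \* g) z]/(f z * g z) normcM.
have z0 := normc_ge0 z.
apply: le_trans (_ : normc (f z) * normc (g z) * (v (normc z) * w (normc z)) <= _).
  by rewrite ler_wpM2l ?qvw// mulr_ge0 ?normc_ge0.
by rewrite mulrACA ler_pM// mulr_ge0 ?normc_ge0// ltW// wfun_gt0.
Qed.

Lemma vboundD v a b f g : vbound v a f -> vbound v b g -> vbound v (a + b) (f + g).
Proof.
move=> fa gb z; apply: le_trans (lerD (fa z) (gb z)).
by rewrite -mulrDl ler_wpM2r ?le_normcD// ltW// wfun_gt0// normc_ge0.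
Qed.

Lemma vboundZ v a (c : R[i]) f : vbound v a f -> vbound v (normc c * a) (c *: f).
Proof.
move=> fa z; rewrite [(c *: f) z]/(c * f z) normcM -mulrA.
by rewrite ler_wpM2l ?normc_ge0.
Qed.

Lemma Hv_predP v f : Hv_pred v f <-> entire f /\ exists e, vbound v e f.
Proof.
split=> [[ef ff]|[ef [e fe]]]; split=> //.
  exists (fine (wnorm v f)) => z; rewrite -lee_fin -wnorm_fin//.
  exact: wnorm_ub.
by apply: le_lt_trans (ltry e); exact: wnorm_le.
Qed.

Lemma vbound_norm v (f : Hv v) e : vbound v e f <-> `|f| <= e%:C.
Proof.
rewrite [`|f|]/(Hv_norm f) /Hv_norm lecR -lee_fin -Hv_fin.
split=> [fe|fe z]; first exact: wnorm_le.
by rewrite -lee_fin; apply: le_trans fe; exact: wnorm_ub.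
Qed.

Lemma Hv_nbhsP v (f : Hv v) (A : set (Hv v)) :
  nbhs f A <-> exists2 e : R, 0 < e & forall g : Hv v, vbound v e (g - f) -> A g.
Proof.
rewrite -filter_from_norm_nbhs; split=> [[e /= e0 eA]|[e e0 eA]].
  have [r r0 re] : exists2 r : R, 0 < r & e = r%:C.
    case: e e0 {eA} => a b; rewrite ltcE/= => /andP[/eqP-> a0].
    by exists a.
  exists (r / 2); first by rewrite divr_gt0.
  move=> g /(@vbound_norm _ (g - f)) ge; apply: eA; rewrite /= -normrN opprB re.
  by apply: (le_lt_trans ge); rewrite ltcR ltr_pdivrMr// ltr_pMr// ltr1n.
exists e%:C; first by rewrite /= ltcR.
move=> g /= ge; apply: eA; apply/(@vbound_norm _ (g - f)).
by rewrite -normrN opprB; exact: ltW.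
Qed.

Lemma entireM f g : entire f -> entire g -> entire (f \* g).
Proof. by move=> ef eg z; exact: derivableM. Qed.

End bounds.

(** * Multiplication on the inductive limit *)

Section Hind.
Local Open Scope classical_set_scope.
Variables (R : realType) (V : dec_weights R).
Local Notation nbhd0 := (indlim_nbhd0 (cover := @Hind_cover R V)).

Lemma Hind_funPP (f : Hind V) : exists n e, entire f /\ vbound (V n) e f.
Proof.
by have /asboolP[n /Hv_predP[ef [e fe]]] := Hind_funP f; exists n, e.
Qed.

Lemma Hind_entire (f : Hind V) : entire f.
Proof. by have [n [e []]] := Hind_funPP f. Qed.

Lemma Hind_nbhd0P (U : set (Hind V)) :
  nbhd0 U <->
  absolutely_convex U /\
  forall n, exists2 e : R, 0 < e & forall f : Hind V, vbound (V n) e f -> U f.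
Proof.
split=> -[aU nU]; split=> // n.
  have /Hv_nbhsP[e e0 eU] := nU n.
  exists e => // f fe.
  have fn : Hv_mem (V n) f.
    by apply/asboolP/Hv_predP; split; [exact: Hind_entire|exists e].
  have -> : f = Hind_incl (MkHv fn) by exact/val_inj.
  by apply: eU; rewrite subr0.
have [e e0 eU] := nU n; apply/Hv_nbhsP; exists e => // f.
by rewrite subr0 => fe; apply: eU.
Qed.

(** This makes the product of two elements of step [n] an element of step [q]. *)
Hypothesis V2 : forall n, exists q, forall t, 0 <= t -> V q t <= V n t ^+ 2.

Lemma Hind_mulP (f g : Hind V) : Hind_mem V (f \* g).
Proof.
have [n [a [ef fa]]] := Hind_funPP f; have [m [b [eg gb]]] := Hind_funPP g.
have [q hq] := V2 (maxn n m).
apply/asboolP; exists q; apply/Hv_predP; split; first exact: entireM.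
exists (a * b); apply: (@vboundM _ (V (maxn n m)) (V (maxn n m))).
- by [].
- by apply: vbound_le (lexx a) fa => t t0; rewrite dwfun_dec// leq_maxl.
- by apply: vbound_le (lexx b) gb => t t0; rewrite dwfun_dec// leq_maxr.
Qed.

Definition Hind_mul (f g : Hind V) : Hind V := MkHind (Hind_mulP f g).

Lemma Hind_mulC f g : Hind_mul f g = Hind_mul g f.
Proof. by apply/val_inj/funext => z /=; exact: mulrC. Qed.

Lemma Hind_mul_comb f a g b h :
  Hind_mul f (a *: g + b *: h) = a *: Hind_mul f g + b *: Hind_mul f h.
Proof.
apply/val_inj/funext => z.
change (f z * (a * g z + b * h z) = a * (f z * g z) + b * (f z * h z)).
by rewrite mulrDr !(mulrCA (f z)).
Qed.

(** In (f+x)(g+y) - fg = xy + (gx + fy) this takes care of gx and fy, and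
    [Hind_mul_nbhd0_nbhd0] of xy. *)
Lemma Hind_mul_nbhd0 f U : nbhd0 U -> nbhd0 [set g | U (Hind_mul f g)].
Proof.
move=> /Hind_nbhd0P[aU nU]; apply/Hind_nbhd0P; split=> [g h a b Ug Uh ab|n] /=.
  by rewrite Hind_mul_comb; exact: aU.
have [m [a [ef fa]]] := Hind_funPP f.
have a0 := vbound_ge0 fa.
have [q hq] := V2 (maxn n m).
have [e e0 eU] := nU q.
exists (e / (a + 1)); first by rewrite divr_gt0// ltr_wpDl.
move=> g gb; apply: eU.
apply: (@vbound_le _ (V q) (V q) (a * (e / (a + 1)))) => //.
  by rewrite mulrCA ler_piMr ?(ltW e0)// ler_pdivrMr ?ltr_wpDl// mul1r lerDl.
apply: (@vboundM _ (V (maxn n m)) (V (maxn n m))) => //.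
- by apply: vbound_le (lexx a) fa => t t0; rewrite dwfun_dec// leq_maxr.
- by apply: vbound_le (lexx _) gb => t t0; rewrite dwfun_dec// leq_maxl.
Qed.

(** The balls of radius [d n] are chosen so that any two of
    them have their product in [U].  The set [W1] of all multipliers of these
    balls into [U], and then the set [W2] of all multipliers of [W1] into [U],
    are absolutely convex because [U] is, and both contain all the balls; this
    bipolar argument avoids convex hulls. *)
Lemma Hind_mul_nbhd0_nbhd0 U : nbhd0 U ->
  exists2 W, nbhd0 W &
    forall f g, W f -> W g -> U (Hind_mul f g).
Proof.
move=> /Hind_nbhd0P[aU nU].
have [qf hq] := choice V2.
have ex_e n : exists e : R, [/\ 0 < e & forall f : Hind V, vbound (V n) e f -> U f].
  by have [e] := nU n; exists e.
have [e he] := choice ex_e.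
(* For n <= m a factor from step n is only used through its norm at most 1 in step
   m, so the radius at step m alone makes the product small. *)
pose d n := Num.min 1 (e (qf n)).
have d0 n : 0 < d n by rewrite lt_min ltr01 (proj1 (he _)).
have dU n m (f g : Hind V) : (n <= m)%N -> vbound (V n) (d n) f -> vbound (V m) (d m) g ->
    U (Hind_mul f g).
  move=> nm fd gd; apply: (proj2 (he (qf m))).
  apply: (@vbound_le _ (V (qf m)) (V (qf m)) (1 * d m)) => //.
    by rewrite mul1r ge_min lexx orbT.
  apply: (@vboundM _ (V m) (V m)) => //; first exact: hq.
  by apply: vbound_le fd => [t t0|]; rewrite ?dwfun_dec// ge_min lexx.
pose B := [set g : Hind V | exists m, vbound (V m) (d m) g].
have BU f g : B f -> B g -> U (Hind_mul f g).
  move=> [n fn] [m gm]; have [nm|/ltnW mn] := leqP n m; first exact: dU fn gm.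
  by rewrite Hind_mulC; exact: dU gm fn.
have disk (P : set (Hind V)) : B `<=` [set g | forall f, P f -> U (Hind_mul f g)] ->
    nbhd0 [set g | forall f, P f -> U (Hind_mul f g)].
  move=> BP; apply/Hind_nbhd0P; split=> [g h a b Ug Uh ab f Pf|n].
    by rewrite Hind_mul_comb; apply: aU => //; [exact: Ug|exact: Uh].
  by exists (d n) => // f fn; apply: BP; exists n.
pose W1 := [set g | forall f, B f -> U (Hind_mul f g)].
pose W2 := [set g | forall f, W1 f -> U (Hind_mul f g)].
exists (W1 `&` W2).
  apply: indlim_nbhd0I; apply: disk => g Bg f; first by move=> Bf; exact: BU.
  by move=> W1f; rewrite Hind_mulC; exact: W1f.
by move=> f g [W1f _] [_ W2g]; exact: W2g.
Qed.

Lemma Hind_mul_continuous : mul_acts_continuously (@Hind_fun R V).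
Proof.
exists (fun fg => Hind_mul fg.1 fg.2) => // -[f g] A [U nU UA].
have n2 := indlim_nbhd0Z 2 nU; have n4 := indlim_nbhd0Z 2 n2.
have [W nW WU] := Hind_mul_nbhd0_nbhd0 n2.
have nf := Hind_mul_nbhd0 f n4; have ng := Hind_mul_nbhd0 g n4.
exists ([set h | ([set x | U (2 *: (2 *: Hind_mul g x))] `&` W) (h - f)],
        [set h | ([set x | U (2 *: (2 *: Hind_mul f x))] `&` W) (h - g)]).
  by split; apply: indlim_nbhd0_nbhs; exact: indlim_nbhd0I.
move=> [h k] [/= [Uh Wh] [Uk Wk]].
suff -> : Hind_mul h k = Hind_mul f g + (Hind_mul (h - f) (k - g) +
    (Hind_mul g (h - f) + Hind_mul f (k - g))).
  apply: UA; apply: indlim_nbhd0D => //; first exact: WU.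
  exact: (indlim_nbhd0D n2).
apply/val_inj/funext => z.
change (h z * k z = f z * g z + ((h z - f z) * (k z - g z) +
  (g z * (h z - f z) + f z * (k z - g z)))).
by ring.
Qed.

End Hind.

(** * Multiplication on the projective limit *)

Section Hproj.
Local Open Scope classical_set_scope.
Local Open Scope complex_scope.
Variables (R : realType) (V : nat -> weight R).
Hypothesis V_homo : forall n m t, (n <= m)%N -> 0 <= t -> V n t <= V m t.

Lemma Hproj_funPP (f : Hproj V) : entire f /\ forall n, exists e, vbound (V n) e f.
Proof.
have /asboolP fV := Hproj_funP f.
split=> [|n]; first by have [] := fV 0%N.
by have /Hv_predP[] := fV n.
Qed.

(** The weights increase with [n], so the bounds in finitely many steps that define
    a basic neighbourhood follow from one bound in the largest step. *)
Lemma Hproj_nbhsP (f : Hproj V) (A : set (Hproj V)) :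
  nbhs f A <-> exists n, exists2 e : R, 0 < e &
    forall g : Hproj V, vbound (V n) e (g \- f) -> A g.
Proof.
pose F : set_system (Hproj V) := [set A | exists n, exists2 e : R, 0 < e &
    forall g : Hproj V, vbound (V n) e (g \- f) -> A g].
have FF : Filter F.
  split.
  - by exists 0%N, 1.
  - move=> P Q [n [a a0 aP]] [m [b b0 bQ]].
    exists (maxn n m), (Num.min a b); first by rewrite lt_min a0.
    move=> g gf; split; [apply: aP|apply: bQ]; apply: vbound_le gf.
    + by move=> t t0; rewrite V_homo// leq_maxl.
    + by rewrite ge_min lexx.
    + by move=> t t0; rewrite V_homo// leq_maxr.
    + by rewrite ge_min lexx orbT.
  - by move=> P Q PQ [n [a a0 aP]]; exists n, a => // g /aP/PQ.
have /(_ A) : F --> f.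
  apply/cvg_sup => n B [_ [[D oD <-] Df] DB].
  have /Hv_nbhsP[e e0 eD] : nbhs (Hproj_incl n f) D by exact: open_nbhs_nbhs.
  by exists n, e => // g gf; apply: DB; apply: eD.
split=> // -[n [e e0 eA]].
have nf : nbhs f --> f by [].
pose Tc n := Topological.class (initial_topology (@Hproj_incl R V n)).
have [/(_ nf n A) fn _] := @cvg_sup (Hproj V) nat Tc (nbhs f) f _.
apply: fn.
have : nbhs (Hproj_incl n f) [set g : Hv (V n) | vbound (V n) e (g \- f)].
  by apply/Hv_nbhsP; exists e.
move=> /(@initial_continuous (Hproj V) (Hv (V n)) (@Hproj_incl R V n) f).
by apply: (@filterS _ (nbhs (f : initial_topology (@Hproj_incl R V n)))) => g; exact: eA.
Qed.

Hypothesis V2 : forall n, exists q, forall t, 0 <= t -> V n t <= V q t ^+ 2.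

Lemma Hproj_mulP (f g : Hproj V) : Hproj_mem V (f \* g).
Proof.
have [ef fV] := Hproj_funPP f; have [eg gV] := Hproj_funPP g.
apply/asboolP => n; apply/Hv_predP; split; first exact: entireM.
have [q hq] := V2 n; have [a fa] := fV q; have [b gb] := gV q.
by exists (a * b); apply: vboundM hq fa gb.
Qed.

Definition Hproj_mul (f g : Hproj V) : Hproj V := MkHproj (Hproj_mulP f g).

Lemma Hproj_mul_continuous : mul_acts_continuously (@Hproj_fun R V).
Proof.
exists (fun fg => Hproj_mul fg.1 fg.2) => // -[f g] A /Hproj_nbhsP[n [e e0 eA]].
have [q hq] := V2 n.
have [_ /(_ q)[a fa]] := Hproj_funPP f; have [_ /(_ q)[b gb]] := Hproj_funPP g.
have a0 := vbound_ge0 fa; have b0 := vbound_ge0 gb.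
pose d := Num.min 1 (e / (1 + (a + b))).
have s0 : 0 < 1 + (a + b) by rewrite ltr_pwDl// addr_ge0.
have d0 : 0 < d by rewrite lt_min ltr01 divr_gt0.
have d1 : d <= 1 by rewrite ge_min lexx.
have de : d * (1 + (a + b)) <= e by rewrite -ler_pdivlMr// ge_min lexx orbT.
exists ([set h : Hproj V | vbound (V q) d (h \- f)],
        [set k : Hproj V | vbound (V q) d (k \- g)]).
  by split; apply/Hproj_nbhsP; exists q, d.
move=> [h k] [/= hf kg]; apply: eA.
have -> : Hproj_mul h k \- Hproj_mul f g =
    (h \- f) \* (k \- g) + ((h \- f) \* g + f \* (k \- g)) :> (R[i]^o -> R[i]^o).
  apply/funext => z; change (h z * k z - f z * g z =
    (h z - f z) * (k z - g z) + ((h z - f z) * g z + f z * (k z - g z))).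
  by ring.
apply: (@vbound_le _ (V n) (V n) (d * d + (d * b + a * d))) => //.
  apply: le_trans de; rewrite mulrDr mulr1 mulrDr (mulrC d a) (addrC (a * d)) lerD2r.
  by rewrite ler_piMr// ltW.
by apply: vboundD; [|apply: vboundD]; apply: (vboundM hq).
Qed.

End Hproj.

(** * Monomials as test functions *)

Section monomials.
Local Open Scope complex_scope.
Variables (R : realType) (M : weight_seq R).

Definition cmonomial (j : nat) : R[i]^o -> R[i]^o := fun z => z ^+ j.

Lemma entire_cmonomial j : entire (cmonomial j).
Proof. by move=> z; exact: exprn_derivable. Qed.

Lemma normcX (z : R[i]) j : normc (z ^+ j) = normc z ^+ j.
Proof. by elim: j => [|j IH]; rewrite ?expr0 ?normc1// !exprS normcM IH. Qed.

Lemma vbound_cmonomial (c : R) j : 0 < c ->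
  vbound (vM M c) (M j / c ^+ j) (cmonomial j).
Proof.
move=> c0 z; rewrite normcX vME ler_pdivrMr ?expR_gt0//.
have := expR_omega_ub M j (mulr_ge0 (ltW c0) (normc_ge0 z)).
rewrite ler_pdivrMr ?mseq_gt0// exprMn => h.
by rewrite mulrAC ler_pdivlMr ?exprn_gt0// mulrC [M j * _]mulrC.
Qed.

Lemma normc_real (a : R) : normc a%:C = `|a|.
Proof. by rewrite /= expr0n addr0 sqrtr_sqr. Qed.

(** Scaled to have norm at most [e] for the weight v_(M,c). *)
Definition smonomial (c e : R) j : R[i]^o -> R[i]^o :=
  (e * c ^+ j / M j)%:C *: cmonomial j.

Lemma entire_smonomial c e j : entire (smonomial c e j).
Proof. by apply: entireZ; exact: entire_cmonomial. Qed.

Lemma vbound_smonomial_ex c e j d : 0 < d ->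
  exists b, vbound (vM M d) b (smonomial c e j).
Proof. by move=> d0; eexists; apply: vboundZ; exact: vbound_cmonomial. Qed.

Lemma vbound_smonomial c e j : 0 < c -> 0 <= e ->
  vbound (vM M c) e (smonomial c e j).
Proof.
move=> c0 e0; have := vboundZ (e * c ^+ j / M j)%:C (vbound_cmonomial j c0).
have Mj := mseq_gt0 M j; have cj := exprn_gt0 j c0.
rewrite normc_real ger0_norm; last by rewrite !mulr_ge0 ?invr_ge0// ltW.
by have -> : e * c ^+ j / M j * (M j / c ^+ j) = e by field; rewrite !gt_eqF.
Qed.

(** At the peak of index j + k the right-hand side is the single term
    (d r)^(j+k)/M_(j+k), and the powers of r cancel. *)
Lemma smonomial_test (c d e r : R) j k :
  log_convex M -> 0 < c -> 0 < d -> 0 <= e ->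
  d * r = M (j + k).+1 / M (j + k)%N ->
  normc (smonomial c e j r%:C * smonomial c e k r%:C) <= expR (omega M (d * r)) ->
  e ^+ 2 * c ^+ (j + k) * M (j + k)%N <= d ^+ (j + k) * M j * M k.
Proof.
move=> lc c0 d0 e0 dr; have M0 := mseq_gt0 M.
have r0 : 0 < r by rewrite -(pmulr_rgt0 _ d0) dr divr_gt0.
rewrite dr (expR_omega_peak _ lc) -dr.
have ev i : normc (smonomial c e i r%:C) = e * c ^+ i / M i * r ^+ i.
  rewrite [smonomial _ _ _ _]/(_%:C * _ ^+ _) normcM normcX !normc_real.
  rewrite !ger0_norm//; first exact: ltW.
  by rewrite !mulr_ge0 ?invr_ge0 ?exprn_ge0// ltW.
rewrite normcM !ev exprMn.
have rp : 0 < r ^+ (j + k) by rewrite exprn_gt0.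
have -> : e * c ^+ j / M j * r ^+ j * (e * c ^+ k / M k * r ^+ k) =
   (e ^+ 2 * c ^+ (j + k) * M (j + k)%N) * (r ^+ (j + k) / (M j * M k * M (j + k)%N)).
  by rewrite !exprD; field; rewrite !gt_eqF.
have -> : d ^+ (j + k) * r ^+ (j + k) / M (j + k)%N =
   (d ^+ (j + k) * M j * M k) * (r ^+ (j + k) / (M j * M k * M (j + k)%N)).
  by field; rewrite !gt_eqF.
by rewrite ler_pM2r// divr_gt0// !mulr_gt0.
Qed.

End monomials.

(** * Moderate growth and the two algebras *)

Section moderate_growth.
Local Open Scope classical_set_scope.
Local Open Scope complex_scope.
Variables (R : realType) (M : weight_seq R).

(** Condition (mg), or (M.2), of the theory of ultradifferentiable functions. *)
Definition moderate_growth (M : nat -> R) := exists2 C : R, 1 <= C &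
     forall j k : nat, M (j + k)%N <= C ^+ (j + k) * M j * M k.

Lemma natS_ge_pmul (c d : R) : 0 < d -> exists n : nat, c <= d * n.+1%:R.
Proof.
move=> d0; exists (Num.truncn (c / d)).
by rewrite mulrC -ler_pdivrMr// ltW// truncnS_gt.
Qed.

Lemma moderate_growth_vM_sqr (C a b t : R) : 0 <= C -> 0 <= t -> 0 <= a -> C * a <= b ->
  (forall j k : nat, M (j + k)%N <= C ^+ (j + k) * M j * M k) ->
  vM M b t <= vM M a t ^+ 2.
Proof.
move=> C0 t0 a0 ab MC; rewrite !vME exprVn lef_pV2 ?posrE ?exprn_gt0 ?expR_gt0//.
apply: (le_trans (expR_omega_sqr C0 (mulr_ge0 a0 t0) MC)).
by rewrite ler_expR omega_le// mulrA ler_wpM2r.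
Qed.

Lemma moderate_growth_Hind : moderate_growth M ->
  mul_acts_continuously (@Hind_fun R (Munder M)).
Proof.
move=> [C C1 MC]; have C0 : 0 <= C := le_trans ler01 C1.
apply: Hind_mul_continuous => n.
have [q hq] := natS_ge_pmul (C * n.+1%:R) ltr01.
exists q => t t0; apply: (moderate_growth_vM_sqr C0) => //.
by rewrite -[leRHS]mul1r.
Qed.

Lemma Mover_homo n m t : (n <= m)%N -> 0 <= t -> Mover M n t <= Mover M m t.
Proof.
move=> nm t0; rewrite ler_expR lerN2 omega_le// ler_wpM2r//.
by rewrite lef_pV2 ?posrE// ler_nat ltnS.
Qed.

Lemma moderate_growth_Hproj : moderate_growth M ->
  mul_acts_continuously (@Hproj_fun R (Mover M)).
Proof.
move=> [C C1 MC]; have C0 : 0 < C := lt_le_trans ltr01 C1.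
apply: Hproj_mul_continuous => [|n]; first exact: Mover_homo.
have [q hq] := natS_ge_pmul (C * n.+1%:R) ltr01.
exists q => t t0; apply: (moderate_growth_vM_sqr (ltW C0)) => //.
by rewrite ler_pdivrMr// ler_pdivlMl// mulrC -[leRHS]mul1r.
Qed.

Definition Hproj_zero : Hproj (Mover M) :=
  @MkHproj R (Mover M) 0 (introT (asboolP _) (fun n => Hv_pred0 (Mover M n))).

Lemma smonomial_Hproj c e j : Hproj_mem (Mover M) (smonomial M c e j).
Proof.
apply/asboolP => n; apply/Hv_predP; split; first exact: entire_smonomial.
exact: vbound_smonomial_ex.
Qed.

Lemma Hproj_moderate_growth : log_convex M ->
  mul_acts_continuously (@Hproj_fun R (Mover M)) -> moderate_growth M.
Proof.
move=> lc [m mE mc].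
have m0 : m (Hproj_zero, Hproj_zero) = Hproj_zero.
  by apply/val_inj/funext => z; rewrite /= mE mul0r.
have := mc (Hproj_zero, Hproj_zero) [set f : Hproj _ | vbound (vM M 1) 1 f].
case.
  rewrite m0.
  apply: (iffRL (Hproj_nbhsP Mover_homo _ _)); exists 0%N, 1; first exact: ltr01.
  by move=> g gb z; have := gb z; rewrite /Mover invr1 /= subr0.
move=> [A B] [/= /(Hproj_nbhsP Mover_homo)[n [a a0 aA]]].
move=> /(Hproj_nbhsP Mover_homo)[n' [b b0 bB]] AB.
pose N := (maxn n n').+1%:R : R; pose e := Num.min a b.
have N1 : 1 <= N by rewrite ler1n.
have N0 : 0 < N by exact: lt_le_trans N1.
have e0 : 0 < e by rewrite lt_min a0.
have key j k : M (j + k)%N <= e^-2 * N ^+ (j + k) * M j * M k.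
  pose f i := MkHproj (smonomial_Hproj N^-1 e i).
  have fb i : vbound (Mover M (maxn n n')) e (f i \- 0).
    move=> z; rewrite /= subr0.
    by apply: vbound_smonomial; rewrite ?invr_gt0// ltW.
  have /= fAB := AB (f j, f k).
  have : vbound (vM M 1) 1 (m (f j, f k)).
    apply: fAB; split.
      apply: aA; apply: vbound_le (fb j) => [t t0|].
        by rewrite Mover_homo// leq_maxl.
      by rewrite ge_min lexx.
    apply: bB; apply: vbound_le (fb k) => [t t0|].
      by rewrite Mover_homo// leq_maxr.
    by rewrite ge_min lexx orbT.
  rewrite mE; pose r := M (j + k).+1 / M (j + k)%N.
  have r0 : 0 < r by rewrite divr_gt0 ?mseq_gt0.
  move=> /(_ r%:C); rewrite normc_real ger0_norm ?(ltW r0)// vME.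
  rewrite ler_pdivrMr ?expR_gt0// !mul1r => hr.
  have := @smonomial_test R M N^-1 1 e r j k lc _ ltr01 (ltW e0) (mul1r r).
  rewrite invr_gt0 mul1r expr1n mul1r => /(_ N0 hr).
  rewrite exprVn mulrAC ler_pdivrMr ?exprn_gt0// -ler_pdivlMl ?exprn_gt0//.
  by congr (_ <= _); ring.
have e2 : 0 < e ^- 2 by rewrite invr_gt0 exprn_gt0.
(* As (0,0) is the only pair of degree 0, a constant factor D is absorbed by D^(j+k). *)
pose D := 1 + e ^- 2.
have D1 : 1 <= D by rewrite lerDl ltW.
exists (D * N) => [|j k]; first by rewrite -[leLHS]mulr1 ler_pM.
have [/eqP|] := eqVneq (j + k)%N 0%N.
  by rewrite addn_eq0 => /andP[/eqP-> /eqP->]; rewrite mseq0 !mulr1.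
rewrite -lt0n => p0; apply: (le_trans (key j k)).
rewrite !ler_wpM2r ?(ltW (mseq_gt0 M _))// exprMn ler_wpM2r ?exprn_ge0 ?(ltW N0)//.
apply: (@le_trans _ _ D); first by rewrite lerDr.
by rewrite ler_eXnr.
Qed.

Lemma smonomial_Hind e j : Hind_mem (Munder M) (smonomial M 1 e j).
Proof.
apply/asboolP; exists 0%N; apply/Hv_predP; split; first exact: entire_smonomial.
exact: vbound_smonomial_ex.
Qed.

(** The neighbourhood [U] is built from the failures of the condition for
    C = (n+1)^2, n = 0, 1, ...; the square leaves a factor (n+1)^(j+k) after the
    test at d = n+1, which no fixed radius can compensate. *)
Lemma Hind_moderate_growth : log_convex M ->
  mul_acts_continuously (@Hind_fun R (Munder M)) -> moderate_growth M.
Proof.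
move=> lc [m mE mc]; apply: contrapT => nM.
have bad (n : nat) : exists jk : nat * nat,
    (n.+1%:R ^+ 2) ^+ (jk.1 + jk.2) * M jk.1 * M jk.2 < M (jk.1 + jk.2)%N.
  apply: contrapT => nj; apply: nM; exists (n.+1%:R ^+ 2).
    by rewrite exprn_ege1// ler1n.
  move=> j k; rewrite leNgt; apply/negP => h; apply: nj; by exists (j, k).
have [jk hjk] := choice bad.
pose p n := ((jk n).1 + (jk n).2)%N.
pose r n := M (p n).+1 / M (p n) / n.+1%:R.
have r0 n : 0 < r n by rewrite !divr_gt0 ?mseq_gt0.
have nr n : n.+1%:R * r n = M (p n).+1 / M (p n) by rewrite mulrC divfK.
pose U := [set f : Hind (Munder M) | forall n,
  normc (f (r n)%:C) <= expR (omega M (n.+1%:R * r n))].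
have nU : indlim_nbhd0 (cover := @Hind_cover R (Munder M)) U.
  apply/Hind_nbhd0P; split=> [f g a b Uf Ug ab n|i].
    change (normc (a * f (r n)%:C + b * g (r n)%:C) <=
      expR (omega M (n.+1%:R * r n))).
    apply: (le_trans (le_normcD _ _)); rewrite !normcM.
    apply: le_trans (_ : (normc a + normc b) * expR (omega M (n.+1%:R * r n)) <= _).
      by rewrite mulrDl lerD// ler_wpM2l ?normc_ge0//.
    rewrite ler_piMl ?expR_ge0//.
    by move: ab; rewrite !normcCE -rmorphD lecR.
  (* Only the constraints of index n < i restrict the radius in step i: for n >= i
     the weight v_(M,n+1) is at most v_(M,i+1). *)
  pose s := 1 + \sum_(n < i) expR (omega M (i.+1%:R * r n)).
  have s1 : 1 <= s by rewrite lerDl sumr_ge0// => n _; exact: expR_ge0.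
  have s0 : 0 < s by exact: lt_le_trans s1.
  exists s^-1; first by rewrite invr_gt0.
  move=> f fs n; have := fs (r n)%:C.
  rewrite normc_real ger0_norm ?(ltW (r0 n))// vME.
  rewrite ler_pdivrMr ?expR_gt0// => /le_trans; apply.
  have [ni|ni] := ltnP n i.
    rewrite ler_pdivrMl//; apply: (@le_trans _ _ s).
      by rewrite /s (bigD1 (Ordinal ni))//= addrCA lerDl addr_ge0// sumr_ge0.
    by rewrite ler_peMr ?(ltW s0)// -expR0 ler_expR omega_ge0.
  apply: (@le_trans _ _ (expR (omega M (i.+1%:R * r n)))).
    by rewrite ler_piMl ?expR_ge0// invf_le1.
  by rewrite ler_expR omega_le// ler_wpM2r ?(ltW (r0 n))// ler_nat ltnS.
have m0 : m (0, 0) = 0 by apply/val_inj/funext => z; rewrite /= mE; exact: mul0r.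
have [] := mc (0, 0) U; first by rewrite m0; exists U => // g Ug; rewrite add0r.
move=> [A B] [/= [VA /Hind_nbhd0P[_ nVA] hA] [VB /Hind_nbhd0P[_ nVB] hB]] AB.
have [a a0 aV] := nVA 0%N; have [b b0 bV] := nVB 0%N.
pose e := Num.min a b; have e0 : 0 < e by rewrite lt_min a0.
have key n : e ^+ 2 * n.+1%:R <= 1.
  pose f i := MkHind (smonomial_Hind e i).
  have fb i : vbound (Munder M 0%N) e (f i).
    by apply: vbound_smonomial; rewrite // ltW.
  have : U (m (f (jk n).1, f (jk n).2)).
    apply: AB; split => /=.
      rewrite -[f _]add0r; apply: hA; apply: aV.
      by apply: vbound_le (fb _); rewrite // ge_min lexx.
    rewrite -[f _]add0r; apply: hB; apply: bV.
    by apply: vbound_le (fb _); rewrite // ge_min lexx orbT.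
  move=> /(_ n); rewrite mE.
  move=> /(@smonomial_test R M 1 n.+1%:R e (r n) _ _ lc ltr01 (ltr0Sn _ _) (ltW e0) (nr n)).
  rewrite expr1n mulr1 -/(p n).
  have := hjk n; rewrite -/(p n) => h1 h2.
  have p0 : (0 < p n)%N.
    rewrite lt0n; apply/eqP => pn0; move: h1; rewrite pn0.
    move/eqP: pn0; rewrite addn_eq0 => /andP[/eqP-> /eqP->].
    by rewrite mseq0 !mulr1 expr0 ltxx.
  set P := n.+1%:R ^+ p n in h1 h2.
  have P0 : 0 < P by rewrite exprn_gt0.
  have MM : 0 < M (jk n).1 * M (jk n).2 by rewrite mulr_gt0 ?mseq_gt0.
  have : e ^+ 2 * P <= 1.
    rewrite -(ler_pM2r (mulr_gt0 P0 MM)) mul1r.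
    apply: le_trans (_ : e ^+ 2 * M (p n) <= _); last by rewrite mulrA.
    rewrite -mulrA ler_wpM2l ?sqr_ge0//; apply: ltW; apply: le_lt_trans h1.
    by rewrite -exprM mulnC exprM expr2 !mulrA.
  apply: le_trans; rewrite ler_wpM2l ?sqr_ge0// ler_eXnr//.
  by rewrite ler1n.
have [n hn] := natS_ge_pmul 2 (exprn_gt0 2 e0).
by have := le_trans hn (key n); rewrite (ler_nat R 2 1).
Qed.
End moderate_growth.

Theorem theorem4p8 (R : realType) (M : weight_seq R) (hM : log_convex M) :
  (mul_acts_continuously (@Hind_fun R (Munder M)) <->
   mul_acts_continuously (@Hproj_fun R (Mover M))) /\
  (mul_acts_continuously (@Hproj_fun R (Mover M)) <->
   exists2 C : R, 1 <= C &
     forall j k : nat, M (j + k)%N <= C ^+ (j + k) * M j * M k).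
Proof.
have proj_mg : mul_acts_continuously (@Hproj_fun R (Mover M)) <-> moderate_growth M.
  by split; [exact: Hproj_moderate_growth|exact: moderate_growth_Hproj].
have ind_mg : mul_acts_continuously (@Hind_fun R (Munder M)) <-> moderate_growth M.
  by split; [exact: Hind_moderate_growth|exact: moderate_growth_Hind].
by split; [rewrite proj_mg|].
Qed.
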